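(* The coefficient $G_2$ satisfies the rising tide property: for every $n\ge1$, every random vector $\mathbf{X}$ in $\mathbb{R}^n$ with finite second moment, mean $\mathbf{m}\neq 0$ and invertible covariance matrix $\Sigma$, and every $\mathbf{c}\in\mathbb{R}^n$ with $\mathbf{c}^T\Sigma^{-1}\mathbf{m}\ge 0$, $$G_2(\mathbf{X})\ge G_2(\mathbf{X}+\mathbf{c}).$$
   Context: For a random vector $\mathbf{X}\sim\mu$ in $\mathbb{R}^n$ with finite second moment, mean $\mathbf{m}\neq 0$ and invertible covariance matrix $\Sigma$, $$G_2(\mathbf{X})=G_2(\mu):=\Bigg(\frac{1}{2\mathbf{m}^T\Sigma^{-1}\mathbf{m}}\int_{\mathbb{R}^n}\int_{\mathbb{R}^n}(\mathbf{x}-\mathbf{y})^T\Sigma^{-1}(\mathbf{x}-\mathbf{y})\,\mu(d\mathbf{x})\,\mu(d\mathbf{y})\Bigg)^{1/2}.$$ *)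

(* Defs.v *)
From HB Require Import structures.
From mathcomp Require Import all_boot all_order all_algebra.
From mathcomp Require Import all_classical all_reals all_analysis.

Set Implicit Arguments.
Unset Strict Implicit.
Unset Printing Implicit Defensive.
Import Order.TTheory GRing.Theory Num.Theory.
Import numFieldNormedType.Exports.

Local Open Scope classical_set_scope.
Local Open Scope ring_scope.

Fact borel_mx_display : measure_display.
Proof. exact: default_measure_display. Qed.

(* The Borel sigma-algebra of the space of matrices (in particular of the
   column vectors 'cV[R]_n), generated by the open sets of its canonical
   topology. *)
Section borel_mx.
Variables (R : realType) (m n : nat).

Definition borel_mx : set (set 'M[R]_(m, n)) := <<s open >>.

Let borel_mx0 : borel_mx set0.
Proof. exact: sigma_algebra0. Qed.

Let borel_mxC A : borel_mx A -> borel_mx (~` A).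
Proof. exact: sigma_algebraC. Qed.

Let borel_mx_bigcup (F : (set 'M[R]_(m, n))^nat) :
  (forall i, borel_mx (F i)) -> borel_mx (\bigcup_i F i).
Proof. exact: sigma_algebra_bigcup. Qed.

HB.instance Definition _ := @isMeasurable.Build borel_mx_display
  'M[R]_(m, n) borel_mx borel_mx0 borel_mxC borel_mx_bigcup.

End borel_mx.

Section translate.
Context d (T : measurableType d) (R : realType) (n : nat).
Variables (X : {mfun T >-> 'cV[R]_n}) (c : 'cV[R]_n).

Definition translate (t : T) : 'cV[R]_n := X t + c.

Let measurable_translate : measurable_fun [set: T] translate.
Proof.
have mD : measurable_fun [set: 'cV[R]_n] (fun x : 'cV[R]_n => x + c).
  apply: (measurability (@open 'cV[R]_n)) => [|_ [A oA <-]]; first by [].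
  rewrite setTI; apply: sub_sigma_algebra.
  apply: open_comp => // x _.
  have := @cvgD _ _ _ (nbhs x) _ (id : 'cV[R]_n -> 'cV[R]_n) (cst c) x c.
  by apply; [exact: cvg_id|exact: cvg_cst].
by apply: (measurableT_comp mD); exact: measurable_funPT.
Qed.

HB.instance Definition _ :=
  isMeasurableFun.Build _ _ _ _ translate measurable_translate.

End translate.

Section G2.
Context (R : realType) (n : nat).
Implicit Types (mu : probability 'cV[R]_n R) (S : 'M[R]_n) (x y : 'cV[R]_n).

Definition second_moment mu : \bar R := ('E_mu[fun x => ((x^T *m x) 0 0)%R])%E.

(* The entries of [mean] and [cov] are meaningful as soon as the second moment
   is finite; [fine] sends infinite values to 0. *)
Definition mean mu : 'cV[R]_n := \col_i fine ('E_mu[fun x => x i 0%R])%E.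

Definition cov mu : 'M[R]_n :=
  \matrix_(i, j) fine (covariance mu (fun x => x i 0) (fun x => x j 0)).

Definition invform S x y : R := (x^T *m invmx S *m y) 0 0.

(* Meaningful when the second moment is finite, [mean mu != 0] and
   [cov mu \in unitmx]. *)
Definition G2 mu : R :=
  Num.sqrt ((2 * invform (cov mu) (mean mu) (mean mu))^-1 *
    fine (\int[mu]_x \int[mu]_y (invform (cov mu) (x - y) (x - y))%:E)%E).

End G2.

(* Main.v *)
(* Translating by [c] leaves the covariance matrix [S] and the double integral
   unchanged and replaces the mean [m] by [m + c]. An invertible covariance
   matrix is positive definite, so
   [(m + c)^T S^-1 (m + c) = m^T S^-1 m + 2 c^T S^-1 m + c^T S^-1 c]
   is at least [m^T S^-1 m > 0], and the prefactor of the integral decreases. *)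

Require Import Defs.
From HB Require Import structures.
From mathcomp Require Import all_boot all_order all_algebra.
From mathcomp Require Import all_classical all_reals all_analysis.
From mathcomp Require Import measurable_realfun ring lra.

Set Implicit Arguments.
Unset Strict Implicit.
Unset Printing Implicit Defensive.
Import Order.TTheory GRing.Theory Num.Theory.
Import numFieldNormedType.Exports.

Local Open Scope classical_set_scope.
Local Open Scope ring_scope.

(** * The quadratic form of the inverse of a symmetric positive semidefinite matrix *)

Section invform_theory.
Variables (R : realType) (n : nat).
Implicit Types (S : 'M[R]_n) (x y z : 'cV[R]_n).

Lemma mulmx_tr_self_eq0 x : (x^T *m x) 0 0 = 0 -> x = 0.
Proof.
rewrite mxE => /eqP; rewrite psumr_eq0 => [/allP x0|i _]; last first.
  by rewrite mxE -expr2 sqr_ge0.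
apply/colP => i; have := x0 i (mem_index_enum i).
by rewrite !mxE -expr2 sqrf_eq0 => /eqP.
Qed.

Lemma invform_sumE S x y :
  invform S x y = \sum_i \sum_j x i 0 * y j 0 * invmx S i j.
Proof.
rewrite /invform mxE exchange_big; apply: eq_bigr => j _.
rewrite mxE mulr_suml; apply: eq_bigr => i _.
by rewrite mxE mulrAC.
Qed.

Lemma invformDl S x y z : invform S (x + y) z = invform S x z + invform S y z.
Proof. by rewrite /invform [(_ + _)^T]linearD/= !mulmxDl mxE. Qed.

Lemma invformDr S x y z : invform S x (y + z) = invform S x y + invform S x z.
Proof. by rewrite /invform mulmxDr mxE. Qed.

Lemma invformC S x y : S^T = S -> invform S x y = invform S y x.
Proof.
move=> symS; have -> (u v : 'cV[R]_n) :
    invform S u v = (u^T *m invmx S *m v)^T 0 0 by rewrite mxE.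
by rewrite !trmx_mul trmxK trmx_inv symS mulmxA.
Qed.

Section positive.
Variable S : 'M[R]_n.
Hypotheses (symS : S^T = S) (unitS : S \in unitmx).
Hypothesis psdS : forall x, 0 <= (x^T *m S *m x) 0 0.

(** With [z = S^-1 x], one has [x = S z]; this carries positivity of the form of [S] over to the
    form of its inverse. *)
Lemma invform_solveE x :
  invform S x x = ((invmx S *m x)^T *m S *m (invmx S *m x)) 0 0.
Proof. by rewrite /invform trmx_mul trmx_inv symS mulmxKV// mulmxA. Qed.

Lemma invform_ge0 x : 0 <= invform S x x.
Proof. by rewrite invform_solveE. Qed.

(* The nonnegative polynomial [(y + t S y)^T S (y + t S y)] in [t] has no
   constant term, so its linear coefficient [2 |S y|^2] vanishes. *)
Lemma psd_ker y : (y^T *m S *m y) 0 0 = 0 -> S *m y = 0.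
Proof.
move=> y0; apply: mulmx_tr_self_eq0.
set w := S *m y; set b := (w^T *m w) 0 0; set a := (w^T *m S *m w) 0 0.
have a0 : 0 <= a by exact: psdS.
have quad t : 0 <= t * b *+ 2 + t ^+ 2 * a.
  have := psdS (y + t *: w).
  rewrite [(_ + _)^T]linearD/= [(_ *: _)^T]linearZ/= !mulmxDl !mulmxDr.
  have -> : y^T *m S = w^T by rewrite /w trmx_mul symS.
  rewrite -!scalemxAr -!scalemxAl -(mulmxA _ S y) -/w.
  have -> : w^T *m y = y^T *m S *m y by rewrite /w trmx_mul symS.
  have ZE (u : R) (A : 'M[R]_1) : (u *: A) 0 0 = u * A 0 0 by rewrite mxE.
  have DE (A B : 'M[R]_1) : (A + B) 0 0 = A 0 0 + B 0 0 by rewrite mxE.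
  rewrite !DE !ZE y0 add0r -/a -/b.
  by have -> : t * b + (t * b + t * (t * a)) = t * b *+ 2 + t ^+ 2 * a
    by ring.
(* The minimizer [- b / a] fails when [a = 0]; with [a + 1] the denominator is positive and the
   value is still a nonpositive multiple of [b ^+ 2], which forces [b = 0]. *)
have := quad (- b / (a + 1)).
have -> : - b / (a + 1) * b *+ 2 + (- b / (a + 1)) ^+ 2 * a =
    - (b ^+ 2 * ((a + 2) / (a + 1) ^+ 2)) by field; lra.
rewrite oppr_ge0 pmulr_lle0; last by rewrite divr_gt0 ?exprn_gt0//; lra.
by move=> b2; apply/eqP; rewrite -sqrf_eq0 eq_le b2 sqr_ge0.
Qed.

(** If the form vanishes at [x], [psd_ker] puts [S^-1 x] in the kernel of [S], so
    [x = S (S^-1 x) = 0]. *)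
Lemma invform_gt0 x : x != 0 -> 0 < invform S x x.
Proof.
move=> x0; rewrite lt_neqAle invform_ge0 andbT eq_sym invform_solveE.
apply: contra x0 => /eqP /psd_ker.
by rewrite mulKVmx// => ->.
Qed.

End positive.
End invform_theory.

(** * Change of variables under a pushforward *)

Section pushforward_integral.
Context d1 d2 (T1 : measurableType d1) (T2 : measurableType d2) (R : realType).
Variables (mu : {measure set T1 -> \bar R}) (phi : T1 -> T2).
Hypothesis mphi : measurable_fun [set: T1] phi.

(* No integrability as in [integral_pushforward]: the positive and negative
   parts are transported separately. *)
Lemma integral_pushforwardT (f : T2 -> \bar R) :
  measurable_fun [set: T2] f ->
  (\int[pushforward mu phi]_y f y = \int[mu]_x f (phi x))%E.
Proof.
move=> mf; rewrite [LHS]integralE [RHS]integralE.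
rewrite (ge0_integral_pushforward mphi)//; last exact: measurable_funepos.
rewrite (ge0_integral_pushforward mphi)//; last exact: measurable_funeneg.
by rewrite preimage_setT -funepos_comp -funeneg_comp.
Qed.

End pushforward_integral.

(** * Measurability, moments and translation of laws on column vectors *)

Section borel_column.
Variables (R : realType) (n : nat).
Local Notation V := 'cV[R]_n.

Lemma measurable_coord (i : 'I_n) :
  measurable_fun [set: V] (fun x : V => x i 0).
Proof.
apply: (measurability _ (RGenOpens.measurableE R)).
move=> _ [_ [a [b ->]] <-]; rewrite setTI; apply: sub_sigma_algebra.
apply: open_comp; last exact: interval_open.
by move=> x _; exact: coord_continuous.
Qed.

(** The sigma-algebra here is the product one, so the form is expanded into coordinates of the two
    projections instead of using continuity on the product space. *)
Lemma measurable_invformB (S : 'M[R]_n) :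
  measurable_fun [set: V * V] (fun p => invform S (p.1 - p.2) (p.1 - p.2)).
Proof.
under eq_fun do rewrite invform_sumE.
apply: measurable_sum => i; apply: measurable_sum => j.
have mB k : measurable_fun [set: V * V] (fun p => (p.1 - p.2) k 0).
  under eq_fun do rewrite !mxE.
  apply: measurable_funB.
    exact: measurableT_comp (measurable_coord k) measurable_fst.
  exact: measurableT_comp (measurable_coord k) measurable_snd.
by apply: measurable_funM => //; apply: measurable_funM.
Qed.

Section moments.
Variable mu : probability V R.
Hypothesis mu2 : (second_moment mu < +oo)%E.

(** The bound is integrable because the second moment and the total mass are finite. It serves for
    coordinates and for products of centered coordinates. *)
Lemma quadratic_growth_integrable (f : V -> R) (a b : R) :
  measurable_fun [set: V] f -> 0 <= a -> 0 <= b ->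
  (forall x, `|f x| <= a * (x^T *m x) 0 0 + b) ->
  mu.-integrable [set: V] (EFin \o f).
Proof.
move=> mf a0 b0 fab.
have msq : measurable_fun [set: V] (fun x : V => (x^T *m x) 0 0).
  under eq_fun do rewrite mxE.
  apply: measurable_sum => i; under eq_fun do rewrite mxE.
  by apply: measurable_funM; exact: measurable_coord.
have sq0 (x : V) : 0 <= (x^T *m x) 0 0.
  by rewrite mxE sumr_ge0// => i _; rewrite mxE -expr2 sqr_ge0.
have isq : mu.-integrable [set: V] (EFin \o (fun x : V => (x^T *m x) 0 0)).
  apply/integrableP; split; first exact/measurable_EFinP.
  move: mu2; rewrite /second_moment unlock; apply: le_lt_trans.
  by under eq_integral do rewrite /= ger0_norm//.
apply: (@le_integrable _ _ _ _ _ _ _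
  (EFin \o (fun x : V => a * (x^T *m x) 0 0 + b))) => //.
- exact/measurable_EFinP.
- by move=> x _ /=; rewrite lee_fin (le_trans (fab x))// ler_norm.
- have -> : EFin \o (fun x : V => a * (x^T *m x) 0 0 + b) =
      ((fun x => a%:E * ((x^T *m x) 0 0)%:E) \+ cst b%:E)%E by [].
  by apply: integrableD => //; [exact: integrableZl|
    exact: finite_measure_integrable_cst].
Qed.

Lemma coord_sqr_le (x : V) i : (x i 0) ^+ 2 <= (x^T *m x) 0 0.
Proof.
rewrite mxE (bigD1 i)//= mxE -expr2 lerDl sumr_ge0// => j _.
by rewrite mxE -expr2 sqr_ge0.
Qed.

Lemma coord_integrable i : mu.-integrable [set: V] (fun x => (x i 0)%:E).
Proof.
apply: (@quadratic_growth_integrable _ 1 1) => //.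
  exact: measurable_coord.
move=> x; have := coord_sqr_le x i; rewrite mul1r -real_normK ?num_real//.
(* From [(t - 1)^2 >= 0], [t <= (t^2 + 1) / 2 <= t^2 + 1] with [t] the absolute value of the
   coordinate. *)
by have := sqr_ge0 (`|x i 0| - 1); have := normr_ge0 (x i 0); nra.
Qed.

Lemma integral_coordD i (c : V) :
  (\int[mu]_x ((x + c)%R i 0)%:E = \int[mu]_x (x i 0)%:E + (c i 0)%:E)%E.
Proof.
under eq_integral do rewrite mxE EFinD.
rewrite integralD//; last 2 first.
- exact: coord_integrable.
- exact: finite_measure_integrable_cst.
by rewrite integral_cst//= probability_setT mule1.
Qed.

Let dev i (x : V) := x i 0 - mean mu i 0.

Lemma dev_mul_integrable i j :
  mu.-integrable [set: V] (EFin \o (fun x => dev i x * dev j x)).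
Proof.
apply: (@quadratic_growth_integrable _ 2
  ((mean mu i 0) ^+ 2 + (mean mu j 0) ^+ 2)) => //.
- by apply: measurable_funM; apply: measurable_funB => //;
    exact: measurable_coord.
- by rewrite addr_ge0 ?sqr_ge0.
move=> x; have := coord_sqr_le x i; have := coord_sqr_le x j; rewrite /dev.
move: (x i 0) (x j 0) (mean mu i 0) (mean mu j 0) (_ 0 0) => u v p q N uN vN.
(* The absolute value of [(u - p)(v - q)] is at most [((u - p)^2 + (v - q)^2) / 2], and
   [(u - p)^2 <= 2 u^2 + 2 p^2], likewise for [v] and [q]. Bounding [u^2] and [v^2] by [N] yields
   the constants [2] and [p^2 + q^2]. *)
by rewrite ler_norml; apply/andP; split;
  have := sqr_ge0 (u + p); have := sqr_ge0 (v + q);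
  have := sqr_ge0 (u - p + (v - q)); have := sqr_ge0 (u - p - (v - q)); nra.
Qed.

Lemma covE i j :
  cov mu i j = fine (\int[mu]_x (dev i x * dev j x)%:E)%E.
Proof.
rewrite mxE covariance.unlock expectation.unlock; congr fine.
by apply: eq_integral => x _; rewrite /dev !mxE expectation.unlock.
Qed.

Lemma trmx_cov : (cov mu)^T = cov mu.
Proof. by apply/matrixP => i j; rewrite !mxE covarianceC. Qed.

(** The form at [a] is the variance of the linear functional with coefficients [a], that is, the
    integral of a square. *)
Lemma cov_psd (a : V) : 0 <= (a^T *m cov mu *m a) 0 0.
Proof.
have int i j : mu.-integrable [set: V]
    (fun x => (a i 0 * a j 0)%:E * (dev i x * dev j x)%:E)%E.
  by apply: integrableZl => //; exact: dev_mul_integrable.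
have -> : (a^T *m cov mu *m a) 0 0 =
    fine (\int[mu]_x ((\sum_i a i 0 * dev i x) ^+ 2)%:E)%E.
  have -> : (\int[mu]_x ((\sum_i a i 0 * dev i x) ^+ 2)%:E =
      \sum_i \sum_j (a i 0 * a j 0 * cov mu i j)%:E)%E.
    under eq_integral => x _.
      rewrite expr2 mulr_suml -sumEFin.
      under eq_bigr => i _.
        rewrite mulr_sumr -sumEFin.
        under eq_bigr => j _ do rewrite mulrACA EFinM.
        over.
      over.
    rewrite integral_sum//=; last by move=> i; exact: integrable_sum.
    apply: eq_bigr => i _; rewrite integral_sum//=.
    apply: eq_bigr => j _; rewrite integralZl//; last exact: dev_mul_integrable.
    by rewrite [RHS]EFinM covE fineK// integrable_fin_num//;
      exact: dev_mul_integrable.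
  under eq_bigr do rewrite sumEFin.
  rewrite sumEFin /= mxE exchange_big; apply: eq_bigr => j _.
  by rewrite mxE mulr_suml; apply: eq_bigr => i _; rewrite mxE mulrAC.
by apply: fine_ge0; apply: integral_ge0 => x _; rewrite lee_fin sqr_ge0.
Qed.

End moments.

(** * Effect of a translation on mean, covariance and double integral *)

Section translation.
Context d (T : measurableType d) (P : probability T R).
Variables (X : {RV P >-> V}) (c : V).
Local Notation mu := (distribution P X).
Local Notation nu := (distribution P (translate X c)).

Lemma measurable_shift : measurable_fun [set: V] (fun x : V => x + c).
Proof.
apply: (measurability (@open V)) => // _ [A oA <-].
rewrite setTI; apply: sub_sigma_algebra; apply: open_comp => // x _.
have := @cvgD _ _ _ (nbhs x) _ (id : V -> V) (cst c) x c.
by apply; [exact: cvg_id|exact: cvg_cst].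
Qed.

(** Both laws are pushforwards of [P], so both sides equal the integral of [f (X t + c)] against
    [P]. *)
Lemma integral_translate (f : V -> \bar R) : measurable_fun [set: V] f ->
  (\int[nu]_x f x = \int[mu]_x f (x + c)%R)%E.
Proof.
move=> mf; rewrite integral_pushforwardT// [RHS]integral_pushforwardT//.
exact: measurableT_comp measurable_shift.
Qed.

Hypothesis mu2 : (second_moment mu < +oo)%E.

Lemma mean_translate : mean nu = mean mu + c.
Proof.
apply/colP => i; rewrite !mxE unlock integral_translate; last first.
  by apply/measurable_EFinP; exact: measurable_coord.
by rewrite integral_coordD// fineD// integrable_fin_num//;
  exact: coord_integrable.
Qed.

(** Each coordinate and its mean move by the same amount, so the deviations are unchanged. *)
Lemma cov_translate : cov nu = cov mu.
Proof.
apply/matrixP => i j; rewrite !covE mean_translate.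
have mdev k (a : R) : measurable_fun [set: V] (fun x : V => x k 0 - a).
  by apply: measurable_funB => //; exact: measurable_coord.
rewrite integral_translate; last first.
  by apply/measurable_EFinP; apply: measurable_funM; exact: mdev.
congr fine; apply: eq_integral => x _; rewrite !mxE.
by congr ((_ * _)%:E); rewrite opprD addrACA subrr addr0.
Qed.

Lemma integral_invformB_translate (S : 'M[R]_n) :
  (forall x, 0 <= invform S x x) ->
  (\int[nu]_x \int[nu]_y (invform S (x - y)%R (x - y)%R)%:E =
   \int[mu]_x \int[mu]_y (invform S (x - y)%R (x - y)%R)%:E)%E.
Proof.
move=> S0; rewrite integral_translate; last first.
  (* The outer change of variables requires the inner integral to be measurable in [x]; Tonelli
     gives this for a nonnegative integrand. *)
  apply: (measurable_fun_fubini_tonelli_F (m2 := nu)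
    (fun p : V * V => (invform S (p.1 - p.2) (p.1 - p.2))%:E)) => //.
    by apply/measurable_EFinP; exact: measurable_invformB.
  by move=> p; rewrite lee_fin.
apply: eq_integral => x _; rewrite integral_translate; last first.
  apply/measurable_EFinP.
  exact: measurableT_comp (measurable_invformB S) (pair1_measurable (x + c)).
by apply: eq_integral => y _; rewrite opprD addrACA subrr addr0.
Qed.

End translation.
End borel_column.

Theorem theorem3 (R : realType) (d : measure_display) (T : measurableType d)
    (P : probability T R) (n : nat) (X : {RV P >-> 'cV[R]_n}) (c : 'cV[R]_n) :
  (1 <= n)%N ->
  (second_moment (distribution P X) < +oo)%E ->
  mean (distribution P X) != 0 ->
  cov (distribution P X) \in unitmx ->
  0 <= invform (cov (distribution P X)) c (mean (distribution P X)) ->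
  G2 (distribution P X) >= G2 (distribution P (translate X c)).
Proof.
move=> _ mu2 m0 unitS cm; set mu := distribution P X in mu2 m0 unitS cm *.
have symS := trmx_cov mu; have psdS := cov_psd mu2.
have S0 := invform_ge0 symS unitS psdS.
rewrite /G2 cov_translate// mean_translate// integral_invformB_translate//.
rewrite ler_sqrt//; last first.
  rewrite mulr_ge0 ?invr_ge0 ?mulr_ge0// fine_ge0//.
  by apply: integral_ge0 => x _; apply: integral_ge0 => y _; rewrite lee_fin.
(* The common factor is nonnegative, even where [fine] would send an infinite integral to 0, so only
   the prefactors remain to be compared. *)
apply: ler_wpM2r.
  apply: fine_ge0; apply: integral_ge0 => x _; apply: integral_ge0 => y _.
  by rewrite lee_fin.
have q0 := invform_gt0 symS unitS psdS m0.
have qle : invform (cov mu) (mean mu) (mean mu) <=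
    invform (cov mu) (mean mu + c) (mean mu + c).
  (* Symmetry makes both cross terms equal to the one in [cm]; the term in [c] alone is nonnegative
     by [S0]. *)
  rewrite invformDl !invformDr (invformC (mean mu) c symS).
  by rewrite -addrA lerDl !addr_ge0.
by rewrite lef_pV2 ?ler_pM2l ?posrE ?mulr_gt0// (lt_le_trans q0).
Qed.
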